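(* (Skew-symmetry) For any logarithmic vertex algebra $V$ and $a,b\in V$, we have $$Y(a,z,\zeta)b=(-1)^{p(a)p(b)}e^{zT}Y(b,-z,\zeta)a.$$ In particular, $X(a,z)b=(-1)^{p(a)p(b)}e^{zT}X(b,-z)a$.
   Context: Conventions. All superspaces, tensor products and Hom's are over $\mathbb C$; $p(v)$ is the parity; formulas with $p$ are for homogeneous elements, extended linearly. $(\phi\otimes\psi)(a\otimes b)=(-1)^{p(\psi)p(a)}\phi(a)\otimes\psi(b)$; $[\cdot,\cdot]$ is the supercommutator; $P(a\otimes b)=(-1)^{p(a)p(b)}b\otimes a$; $I$ is the identity. $z,z_1,z_2$, $\zeta,\zeta_1,\zeta_2$ are commuting even formal variables ($\zeta_i$ plays the role of $\log z_i$). $D_z=\partial_z+z^{-1}\partial_\zeta$, $z_{12}=z_1-z_2$, $\vartheta_{12}=\zeta_1-\sum_{n\ge1}\frac1n z_1^{-n}z_2^n$, $\vartheta_{21}=\zeta_2-\sum_{n\ge1}\frac1n z_1^{n}z_2^{-n}$. $\mathrm{LF}(V)=\mathrm{Hom}(V,V(\!(z)\!)[\zeta])$ with its natural superspace structure. Braiding map. A braiding map on $V$ is an even element $\mathcal S\in\mathrm{End}(V)\otimes\mathrm{End}(V)$ with $\mathcal SP=P\mathcal S$ and $[\mathcal S_{12},\mathcal S_{23}]=[\mathcal S_{13},\mathcal S_{23}]=[\mathcal S_{12},\mathcal S_{13}]=0$ on $V^{\otimes3}$, where $\mathcal S_{12}=\mathcal S\otimes I$, $\mathcal S_{23}=I\otimes\mathcal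 S$, $\mathcal S_{13}=(I\otimes P)\mathcal S_{12}(I\otimes P)$. Logarithmic vertex algebra (logVA) $(V,\boldsymbol1,T,Y,\mathcal S)$: a superspace $V$, an even vector $\boldsymbol1$, an even $T\in\mathrm{End}(V)$, an even linear map $Y:V\to\mathrm{LF}(V)$, $a\mapsto Y(a,z)$, and a braiding map $\mathcal S$ on $V$ such that, with $Y(z)(a\otimes b):=Y(a,z)b$: (vacuum) $Y(\boldsymbol1,z)=I$, $Y(a,z)\boldsymbol1\in V[\![z]\!]$, $Y(a,z)\boldsymbol1|_{z=0}=a$, $T\boldsymbol1=0$; (covariance) $[T,Y(a,z)]=D_zY(a,z)$; (nilpotence) $\mathcal S$ is locally nilpotent on $V\otimes V$; (locality) for all $a,b\in V$ there is $N\in\mathbb Z_+$ such that for all $c\in V$, $Y(z_1)(I\otimes Y(z_2))z_{12}^Ne^{\vartheta_{12}\mathcal S_{12}}(a\otimes b\otimes c)=(-1)^{p(a)p(b)}Y(z_2)(I\otimes Y(z_1))z_{12}^Ne^{\vartheta_{21}\mathcal S_{12}}(b\otimes a\otimes c)$; (hexagon) $\mathcal S(Y(z)\otimes I)=(Y(z)\otimes I)(\mathcal S_{13}+\mathcal S_{23})$ on $V^{\otimes3}$. Notation. $Y(a,z,\zeta)=Y(a,z)$ with the dependence on $\zeta$ displayed; $Y(b,-z,\zeta)$ is obtained by replacing $z$ by $-z$ and leaving $\zeta$ unchanged. $X(a,z)=Y(a,z,\zeta)|_{\zeta=0}$. *)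

(* Defs.v *)
From HB Require Import structures.
From mathcomp Require Import all_boot all_order all_algebra generic_quotient.
From mathcomp Require Import boolp classical_sets functions cardinality fsbigop.
From mathcomp Require Import reals.
From mathcomp Require Import complex.
Set Implicit Arguments.
Unset Strict Implicit.
Unset Printing Implicit Defensive.
Import Order.TTheory GRing.Theory Num.Theory.
Local Open Scope quotient_scope.
Local Open Scope classical_set_scope.
Local Open Scope ring_scope.

(* The tensor product of two modules: formal finite sums of pure tensors (the
   list [:: (a1, b1); ...; (an, bn)] stands for a1 (x) b1 + ... + an (x) bn)
   modulo the congruence generated by bilinearity. *)
Inductive tens_rel (K : comNzRingType) (V W : lmodType K) :
    seq (V * W) -> seq (V * W) -> Prop :=
| tens_refl s : tens_rel s s
| tens_sym s t : tens_rel s t -> tens_rel t s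
| tens_trans s t u : tens_rel s t -> tens_rel t u -> tens_rel s u
| tens_cat s s' t t' :
    tens_rel s s' -> tens_rel t t' -> tens_rel (s ++ t) (s' ++ t')
| tens_catC s t : tens_rel (s ++ t) (t ++ s)
| tens_0l b : tens_rel [:: (0, b)] [::]
| tens_Dl a a' b : tens_rel [:: (a + a', b)] [:: (a, b); (a', b)]
| tens_Dr a b b' : tens_rel [:: (a, b + b')] [:: (a, b); (a, b')]
| tens_Z k a b : tens_rel [:: (k *: a, b)] [:: (a, k *: b)].

Section TensorProduct.
Variables (K : comNzRingType) (V W : lmodType K).
Implicit Types s t : seq (V * W).

Definition tens_relb s t : bool := `[< tens_rel s t >].

Lemma tens_relb_refl : reflexive tens_relb.
Proof. by move=> s; apply/asboolP; exact: tens_refl. Qed.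
Lemma tens_relb_sym : symmetric tens_relb.
Proof.
by move=> s t; apply/asboolP/asboolP => h; exact: tens_sym.
Qed.
Lemma tens_relb_trans : transitive tens_relb.
Proof.
move=> t s u /asboolP st /asboolP tu; apply/asboolP; exact: tens_trans st tu.
Qed.

Definition tens_equiv : equiv_rel (seq (V * W)) :=
  EquivRel tens_relb tens_relb_refl tens_relb_sym tens_relb_trans.

Definition tens : Type := {eq_quot tens_equiv}.
HB.instance Definition _ := Choice.on tens.

Definition tens_class (s : seq (V * W)) : tens := (\pi_({eq_quot tens_equiv}) s)%qT.
Definition tens_repr (x : tens) : seq (V * W) := repr (x : {eq_quot tens_equiv}).

Lemma tens_classP s t : tens_class s = tens_class t <-> tens_rel s t.
Proof.
split=> [/eqmodP/asboolP//|h]; exact/eqmodP/asboolP.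
Qed.
Lemma tens_reprK (x : tens) : tens_class (tens_repr x) = x.
Proof. exact: (@reprK _ {eq_quot tens_equiv}). Qed.
Lemma tens_repr_class s : tens_rel (tens_repr (tens_class s)) s.
Proof. by apply/tens_classP; rewrite tens_reprK. Qed.

Definition scale_seq (k : K) s : seq (V * W) := [seq (k *: p.1, p.2) | p <- s].
Definition tens_zero : tens := tens_class [::].
Definition tens_add (x y : tens) : tens := tens_class (tens_repr x ++ tens_repr y).
Definition tens_scale (k : K) (x : tens) : tens :=
  tens_class (scale_seq k (tens_repr x)).
Definition tens_opp (x : tens) : tens := tens_scale (- 1) x.

Lemma tens_cons s s' p : tens_rel s s' -> tens_rel (p :: s) (p :: s').
Proof. by move=> h; apply: (@tens_cat _ _ _ [:: p] [:: p]) => //; exact: tens_refl. Qed.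

Lemma tens_rel_cat_map (f g h : V * W -> V * W) s :
  (forall p, tens_rel [:: h p] [:: f p; g p]) ->
  tens_rel (map h s) (map f s ++ map g s).
Proof.
move=> H; elim: s => [|p s ih] /=; first exact: tens_refl.
apply: tens_trans (@tens_cat _ _ _ [:: h p] _ _ _ (H p) ih) _ => /=.
apply: tens_cons; rewrite -[g p :: _ ++ _]/([:: g p] ++ _) -[_ ++ _ :: _](cat_rcons (g p)).
rewrite catA -cats1; apply: tens_cat; [exact: tens_catC | exact: tens_refl].
Qed.

Lemma scale_seq_rel k s t : tens_rel s t -> tens_rel (scale_seq k s) (scale_seq k t).
Proof.
elim=> {s t} [s|s t _|s t u _ h1 _ h2|s s' t t' _ h1 _ h2|s t|b|a a' b|a b b'|l a b] /=.
- exact: tens_refl.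
- exact: tens_sym.
- exact: tens_trans h1 h2.
- by rewrite /scale_seq !map_cat; exact: tens_cat.
- by rewrite /scale_seq !map_cat; exact: tens_catC.
- by rewrite scaler0; exact: tens_0l.
- by rewrite scalerDr; exact: tens_Dl.
- exact: tens_Dr.
- by rewrite scalerA mulrC -scalerA; exact: tens_Z.
Qed.

Lemma tens_addE s t : tens_add (tens_class s) (tens_class t) = tens_class (s ++ t).
Proof. by apply/tens_classP; apply: tens_cat; exact: tens_repr_class. Qed.
Lemma tens_scaleE k s : tens_scale k (tens_class s) = tens_class (scale_seq k s).
Proof. by apply/tens_classP; apply: scale_seq_rel; exact: tens_repr_class. Qed.

Lemma tens_addA : associative tens_add.
Proof.
move=> x y z; rewrite -(tens_reprK x) -(tens_reprK y) -(tens_reprK z).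
by rewrite !tens_addE catA.
Qed.
Lemma tens_addC : commutative tens_add.
Proof.
move=> x y; rewrite -(tens_reprK x) -(tens_reprK y) !tens_addE.
by apply/tens_classP; exact: tens_catC.
Qed.
Lemma tens_add0 : left_id tens_zero tens_add.
Proof. by move=> x; rewrite -(tens_reprK x) tens_addE. Qed.

Lemma tens_scaleDl x k l :
  tens_scale (k + l) x = tens_add (tens_scale k x) (tens_scale l x).
Proof.
rewrite -(tens_reprK x) !tens_scaleE tens_addE; apply/tens_classP.
by apply: tens_rel_cat_map => p; rewrite scalerDl; exact: tens_Dl.
Qed.
Lemma tens_scale0 x : tens_scale 0 x = tens_zero.
Proof.
rewrite -(tens_reprK x) tens_scaleE; apply/tens_classP.
elim: (tens_repr x) => [|p s ih] /=; first exact: tens_refl.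
rewrite scale0r; apply: (@tens_cat _ _ _ [:: _] [::] _ [::]) => //.
exact: tens_0l.
Qed.
Lemma tens_scale1 : left_id 1 tens_scale.
Proof.
move=> x; rewrite -(tens_reprK x) tens_scaleE; congr tens_class.
by rewrite /scale_seq -[RHS]map_id; apply: eq_map => -[a b] /=; rewrite scale1r.
Qed.
Lemma tens_scaleDr : right_distributive tens_scale tens_add.
Proof.
move=> k x y; rewrite -(tens_reprK x) -(tens_reprK y).
by rewrite !(tens_addE, tens_scaleE) /scale_seq map_cat.
Qed.
Lemma tens_scaleA k l x : tens_scale k (tens_scale l x) = tens_scale (k * l) x.
Proof.
rewrite -(tens_reprK x) !tens_scaleE /scale_seq -map_comp; congr tens_class.
by apply: eq_map => -[a b] /=; rewrite scalerA.
Qed.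
Lemma tens_addN : left_inverse tens_zero tens_opp tens_add.
Proof.
move=> x; rewrite -{2}(tens_scale1 x) /tens_opp -tens_scaleDl.
by rewrite addNr tens_scale0.
Qed.

HB.instance Definition _ :=
  GRing.isZmodule.Build tens tens_addA tens_addC tens_add0 tens_addN.
HB.instance Definition _ := GRing.Zmodule_isLmodule.Build K tens
  tens_scaleA tens_scale1 tens_scaleDr (fun v k l => tens_scaleDl v k l).

Definition tpure (a : V) (b : W) : tens := tens_class [:: (a, b)].

(* The linear map out of the tensor product induced by f; it has the expected
   meaning (lemma tlift_pure) only when f is bilinear. *)
Definition tlift (U : lmodType K) (f : V -> W -> U) (x : tens) : U :=
  \sum_(p <- tens_repr x) f p.1 p.2.

Lemma tpure_linl b : linear (tpure ^~ b).
Proof.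
move=> k a a'; rewrite -[k *: tpure a b]/(tens_scale _ _) tens_scaleE.
by rewrite -[RHS]/(tens_add _ _) tens_addE; apply/tens_classP; exact: tens_Dl.
Qed.
Lemma tpure_linr a : linear (tpure a).
Proof.
move=> k b b'; rewrite -[k *: tpure a b]/(tens_scale _ _) tens_scaleE.
rewrite -[RHS]/(tens_add _ _) tens_addE; apply/tens_classP => /=.
apply: tens_trans (tens_Dr _ _ _) _.
apply: (@tens_cat _ _ _ [:: _] [:: _] [:: _] [:: _]); last exact: tens_refl.
exact/tens_sym/tens_Z.
Qed.

Lemma tens_decomp (x : tens) : x = \sum_(p <- tens_repr x) tpure p.1 p.2.
Proof.
rewrite -{1}(tens_reprK x); elim: (tens_repr x) => [|[a b] s ih].
  by rewrite big_nil.
by rewrite big_cons -ih -[RHS]/(tens_add _ _) tens_addE.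
Qed.

Section Lift.
Variables (U : lmodType K) (f : V -> W -> U).
Hypotheses (fl : forall b, linear (f ^~ b)) (fr : forall a, linear (f a)).

Lemma tlift_class s : tlift f (tens_class s) = \sum_(p <- s) f p.1 p.2.
Proof.
rewrite /tlift; move: (tens_repr_class s); move: (tens_repr _) => r.
have fZl k a b : f (k *: a) b = k *: f a b.
  have f0 : f 0 b = 0.
    by have := fl b (-1) 0 0; rewrite scaler0 addr0 scaleN1r addNr.
  by have := fl b k a 0; rewrite !addr0 f0 addr0.
have fZr k a b : f a (k *: b) = k *: f a b.
  have f0 : f a 0 = 0.
    by have := fr a (-1) 0 0; rewrite scaler0 addr0 scaleN1r addNr.
  by have := fr a k b 0; rewrite !addr0 f0 addr0.
elim=> {r s} [s|s t _ ->|s t u _ h1 _ h2|s s' t t' _ h1 _ h2|s t|b|a a' b|a b b'|l a b] //=.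
- by rewrite h1.
- by rewrite !big_cat /= h1 h2.
- by rewrite !big_cat /= addrC.
- by rewrite big_seq1 big_nil /= -[0 in LHS](scale0r 0) fZl scale0r.
- rewrite !big_cons !big_nil /= !addr0.
  by have := fl b 1 a a'; rewrite !scale1r.
- rewrite !big_cons !big_nil /= !addr0.
  by have := fr a 1 b b'; rewrite !scale1r.
- by rewrite !big_seq1 /= fZl fZr.
Qed.

Lemma tlift_pure a b : tlift f (tpure a b) = f a b.
Proof. by rewrite tlift_class big_seq1. Qed.

Lemma tlift_linear : linear (tlift f).
Proof.
move=> k x y; rewrite -(tens_reprK x) -(tens_reprK y).
rewrite -[k *: tens_class _]/(tens_scale _ _) tens_scaleE.
rewrite -[X in tlift f X]/(tens_add _ _) tens_addE !tlift_class big_cat /=.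
congr (_ + _); rewrite scaler_sumr big_map; apply: eq_bigr => -[a b] _ /=.
have f0 : f 0 b = 0.
  by have := fl b (-1) 0 0; rewrite scaler0 addr0 scaleN1r addNr.
by have := fl b k a 0; rewrite !addr0 f0 addr0.
Qed.
End Lift.
End TensorProduct.

Notation "a ⊗ b" := (tpure a b) (at level 40, left associativity).

Section TensorMaps.
Variable K : comNzRingType.
Implicit Types U V W : lmodType K.

(* No Koszul sign: used only when g is even. *)
Definition tmap V V' W W' (f : V -> V') (g : W -> W') : tens V W -> tens V' W' :=
  tlift (fun a b => f a ⊗ g b).

Definition tassoc U V W : tens (tens U V) W -> tens U (tens V W) :=
  tlift (fun x c => tlift (fun a b => a ⊗ (b ⊗ c)) x).
Definition tassocV U V W : tens U (tens V W) -> tens (tens U V) W :=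
  tlift (fun a y => tlift (fun b c => (a ⊗ b) ⊗ c) y).
End TensorMaps.

Record superspace (K : comNzRingType) := Superspace {
  super_sort :> lmodType K;
  (* the projections onto the even (false) and odd (true) parts *)
  sproj : bool -> {linear super_sort -> super_sort};
  sprojD : forall v, sproj false v + sproj true v = v;
  sproj_sproj : forall i j v, sproj i (sproj j v) = if i == j then sproj j v else 0
}.
Arguments sproj {K s}.

Section Super.
Variables (K : comNzRingType) (V : superspace K).

Definition has_parity (i : bool) (v : V) := sproj i v = v.
Definition map_has_parity (i : bool) (f : V -> V) :=
  forall j v, has_parity j v -> has_parity (i (+) j) (f v).

(* The bilinear extension of (a, b) |-> (-1)^{p(a)p(b)} F a b, defined for
   homogeneous a and b (lemma koszul_homogeneous). *)
Definition koszul (U : lmodType K) (F : V -> V -> U) (a b : V) : U :=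
  \sum_(i : bool) \sum_(j : bool)
    (-1) ^+ (i && j) *: F (sproj i a) (sproj j b).

Lemma koszul_homogeneous (U : lmodType K) (F : V -> V -> U) i j a b :
  (forall b, linear (F ^~ b)) -> (forall a, linear (F a)) ->
  has_parity i a -> has_parity j b ->
  koszul F a b = (-1) ^+ (i && j) *: F a b.
Proof.
move=> Fl Fr ia jb.
have F0l c : F 0 c = 0.
  by have := Fl c (-1) 0 0; rewrite scaler0 addr0 scaleN1r addNr.
have F0r c : F c 0 = 0.
  by have := Fr c (-1) 0 0; rewrite scaler0 addr0 scaleN1r addNr.
rewrite /koszul (bigD1 i) //= [X in _ + X]big1 ?addr0; last first.
  move=> i' ii'; apply: big1 => j' _.
  by rewrite -ia sproj_sproj (negbTE ii') F0l scaler0.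
rewrite (bigD1 j) //= [X in _ + X]big1 ?addr0 ?ia ?jb// => j' jj'.
by rewrite -jb sproj_sproj (negbTE jj') F0r scaler0.
Qed.

(* P (a ⊗ b) = (-1)^{p(a)p(b)} b ⊗ a *)
Definition tswap : tens V V -> tens V V :=
  tlift (koszul (fun a b => b ⊗ a)).

(* (f ⊗ g)(a ⊗ b) = (-1)^{p(g)p(a)} f a ⊗ g b, for g of parity j *)
Definition stmap (j : bool) (f g : V -> V) : tens V V -> tens V V :=
  tlift (fun a b => \sum_(i : bool) (-1) ^+ (j && i) *: (f (sproj i a) ⊗ g b)).

(* S, as an operator on V ⊗ V, is an even element of End(V) ⊗ End(V): a finite
   sum of f ⊗ g with f and g homogeneous of the same parity.  (Over a field
   End(V) ⊗ End(V) is a subspace of End(V ⊗ V).) *)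
Definition even_tensor_endo (S : tens V V -> tens V V) :=
  exists (n : nat) (j : 'I_n -> bool) (f g : 'I_n -> {linear V -> V}),
    (forall k, map_has_parity (j k) (f k) /\ map_has_parity (j k) (g k)) /\
    forall x, S x = \sum_k stmap (j k) (f k) (g k) x.

Local Notation V2 := (tens V V).
Local Notation V3 := (tens (tens V V) V).

(* Operators on the threefold tensor product.  Only even maps are placed on a
   tensor factor, so no sign occurs. *)
Definition op12 (S : V2 -> V2) : V3 -> V3 := tmap S id.
Definition op23 (S : V2 -> V2) : V3 -> V3 :=
  @tassocV K V V V \o tmap id S \o @tassoc K V V V.
Definition op13 (S : V2 -> V2) : V3 -> V3 := op23 tswap \o op12 S \o op23 tswap.

Record is_braiding_map (S : V2 -> V2) : Prop := IsBraidingMap {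
  braiding_even : even_tensor_endo S;
  braiding_swap : S \o tswap =1 tswap \o S;
  braiding_12_23 : op12 S \o op23 S =1 op23 S \o op12 S;
  braiding_13_23 : op13 S \o op23 S =1 op23 S \o op13 S;
  braiding_12_13 : op12 S \o op13 S =1 op13 S \o op12 S
}.
End Super.

(* Exponents: (n, i) is the monomial z^n ζ^i.  A formal series in z, ζ with
   coefficients in V is a function expo -> V, and a formal series in z1, ζ1,
   z2, ζ2 is a function expo * expo -> V. *)
Notation expo := (int * nat)%type.

Section Series.
Variable K : numFieldType.

(* The series of maps Phi applied to the series G.  The sum gathers the finitely
   many nonzero terms (it is 0 by convention if there are infinitely many). *)
Definition fapp (I : nmodType) (U W : lmodType K) (Phi : I -> U -> W)
    (G : I -> U) : I -> W :=
  fun e => \sum_(p \in [set p : I * I | p.1 + p.2 = e]) Phi p.1 (G p.2).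

Definition fscale (I : nmodType) (U : lmodType K) (g : I -> K) : (I -> U) -> I -> U :=
  fapp (fun e v => g e *: v).

Definition fpow (I : nmodType) (g : I -> K) (k : nat) : I -> K :=
  iter k (@fscale I K^o g) (fun e => (e == 0)%:R).

(* membership in V((z))[ζ] *)
Definition is_log_laurent (V : lmodType K) (f : expo -> V) : Prop :=
  (exists d : nat, forall i n, (d <= i)%N -> f (n, i) = 0) /\
  (forall i, exists N : int, forall n : int, n < N -> f (n, i) = 0).

(* D_z = d/dz + z^-1 d/dζ *)
Definition Dz (V : lmodType K) (f : expo -> V) : expo -> V :=
  fun e => (e.1 + 1)%:~R *: f (e.1 + 1, e.2) + (e.2.+1)%:R *: f (e.1 + 1, e.2.+1).

Definition subst_negz (V : lmodType K) (f : expo -> V) : expo -> V :=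
  fun e => (-1 : K) ^ e.1 *: f e.

(* The substitution ζ = 0, with V((z)) seen inside V((z))[ζ]. *)
Definition subst_zeta0 (V : lmodType K) (f : expo -> V) : expo -> V :=
  fun e => if e.2 == 0%N then f e else 0.

(* the coefficients of e^{zT} *)
Definition exp_zT (V : lmodType K) (T : V -> V) : expo -> V -> V :=
  fun e v => match e with
  | (Posz k, 0%N) => (k`!%:R)^-1 *: iter k T v
  | _ => 0
  end.

Definition z12 : expo * expo -> K := fun e =>
  (e == ((1, 0%N), (0, 0%N)))%:R - (e == ((0, 0%N), (1, 0%N)))%:R.

(* ϑ12 = ζ1 - sum_(n >= 1) (1/n) z1^-n z2^n, and ϑ21 is obtained from it by
   exchanging the indices 1 and 2. *)
Definition theta12 : expo * expo -> K := fun e =>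
  let: ((m, i), (n, j)) := e in
  (e == ((0, 1%N), (0, 0%N)))%:R
  - (if [&& i == 0%N, j == 0%N, 0 < n & m == - n] then (n%:~R)^-1 else 0).
Definition theta21 : expo * expo -> K := fun e => theta12 (e.2, e.1).

(* e^{θ A} x, for an operator A which is nilpotent on x *)
Definition fexp_op (U : lmodType K) (theta : expo * expo -> K) (A : U -> U) (x : U) :
    expo * expo -> U :=
  fun e => \sum_(k \in [set: nat]) ((k`!%:R)^-1 * fpow theta k e) *: iter k A x.
End Series.

Section LogVA.
Variable K : numFieldType.

Section StateField.
Variables (V : superspace K) (Y : V -> V -> expo -> V).

(* coefficients of Y(z), Y(z1)(I ⊗ Y(z2)) and Y(z2)(I ⊗ Y(z1)) *)
Definition Yten (e : expo) : tens V V -> V := tlift (fun a b => Y a b e).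
Definition YY12 (e : expo * expo) : tens (tens V V) V -> V :=
  Yten e.1 \o tmap id (Yten e.2) \o @tassoc K V V V.
Definition YY21 (e : expo * expo) : tens (tens V V) V -> V :=
  Yten e.2 \o tmap id (Yten e.1) \o @tassoc K V V V.
End StateField.

(* logva_Y a b is the series Y(a, z) b *)
Record logVA (V : superspace K) := LogVA {
  logva_vac : V;
  logva_T : {linear V -> V};
  logva_Y : V -> V -> expo -> V;
  logva_S : {linear tens V V -> tens V V};
  logva_vac_even : has_parity false logva_vac;
  logva_T_even : map_has_parity false logva_T;
  logva_Y_linl : forall b, linear (logva_Y ^~ b);
  logva_Y_linr : forall a, linear (logva_Y a);
  logva_Y_field : forall a b, is_log_laurent (logva_Y a b);
  logva_Y_even : forall i j a b e, has_parity i a -> has_parity j b ->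
    has_parity (i (+) j) (logva_Y a b e);
  logva_braiding : is_braiding_map logva_S;
  logva_vacuum_left : forall b e,
    logva_Y logva_vac b e = if e == 0 then b else 0;
  logva_vacuum_right_regular : forall a (n : int) i,
    (n < 0) || (0 < i)%N -> logva_Y a logva_vac (n, i) = 0;
  logva_vacuum_right_value : forall a, logva_Y a logva_vac 0 = a;
  logva_vacuum_T : logva_T logva_vac = 0;
  logva_covariance : forall a b e,
    logva_T (logva_Y a b e) - logva_Y a (logva_T b) e = Dz (logva_Y a b) e;
  logva_nilpotence : forall x, exists n, iter n logva_S x = 0;
  logva_locality : forall a b, exists N : nat, forall c e,
    fapp (YY12 logva_Y)
      (fscale (fpow (@z12 K) N)
        (fexp_op (@theta12 K) (op12 logva_S) ((a ⊗ b) ⊗ c))) e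
    = koszul (fun a' b' =>
        fapp (YY21 logva_Y)
          (fscale (fpow (@z12 K) N)
            (fexp_op (@theta21 K) (op12 logva_S) ((b' ⊗ a') ⊗ c))) e) a b;
  logva_hexagon : forall e x,
    logva_S (tmap (Yten logva_Y e) id x)
    = tmap (Yten logva_Y e) id (op13 logva_S x + op23 logva_S x)
}.

Definition logva_X (V : superspace K) (A : logVA V) (a b : V) : expo -> V :=
  subst_zeta0 (logva_Y A a b).
End LogVA.

(* Main.v *)
Require Import Defs.
From mathcomp Require Import all_boot all_order all_algebra reals complex.
From mathcomp Require Import boolp classical_sets functions cardinality fsbigop.
From mathcomp Require Import finmap zify ring.
Set Implicit Arguments.
Unset Strict Implicit.
Unset Printing Implicit Defensive.
Import Order.TTheory GRing.Theory Num.Theory.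
Local Open Scope ring_scope.

(* Take c = vac in the locality axiom and let W(z1, ζ1, z2, ζ2) be its left-hand
   side.  Y(b, z2) vac has no ζ2 and no negative power of z2, hence neither has
   W; by locality W has no ζ1 and no negative power of z1 either.  Since
   D = D_z1 + D_z2 is a derivation killing z12 and ϑ12, and since T vac = 0,
   covariance gives T W = D W, so that W(z, 0) = e^{zT} W(0, -z).
   As W(z, 0) = z^N Y(z, ζ) e^{ζS} (a ⊗ b) and W(0, z) is up to signs
   z^N Y(z, ζ) e^{ζS} (b ⊗ a), the series Y(z, ζ) e^{ζS} is independent of ζ and
   skew-symmetric; because S commutes with the swap, skew-symmetry propagates to
   every power of ζ. *)

(** * Linear maps and finitely supported sums *)

Section LinearPredicate.
Variables (K : pzRingType) (U W : lmodType K) (f : U -> W).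
Hypothesis fl : linear f.

Lemma lin0 : f 0 = 0.
Proof. by have := fl (-1) 0 0; rewrite scaler0 addr0 scaleN1r addNr. Qed.

Lemma linD x y : f (x + y) = f x + f y.
Proof. by have := fl 1 x y; rewrite !scale1r. Qed.

Lemma linZ k x : f (k *: x) = k *: f x.
Proof. by have := fl k x 0; rewrite !addr0 lin0 addr0. Qed.

Lemma lin_sum (T : Type) (r : seq T) (P : pred T) (F : T -> U) :
  f (\sum_(i <- r | P i) F i) = \sum_(i <- r | P i) f (F i).
Proof. exact: (big_morph f linD lin0). Qed.
End LinearPredicate.

Lemma scale_linear (K : comPzRingType) (U : lmodType K) k c (u v : U) :
  k *: (c *: u + v) = c *: (k *: u) + k *: v.
Proof. by rewrite scalerDr !scalerA mulrC. Qed.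

Section FiniteSupport.
Local Open Scope classical_set_scope.
Variables (T : choiceType).

(** A sum over an arbitrary set is 0 by convention when its support is infinite, so linearity and
    exchange of sums below pass through a finite set [A] that contains the support. *)
Lemma fsumE (V : nmodType) (A P : set T) (F : T -> V) :
  finite_set A -> (forall x, P x -> F x <> 0 -> A x) ->
  \sum_(x \in P) F x = \sum_(x <- fset_set A | x \in P) F x.
Proof.
move=> finA supp; rewrite fsbig_mkcond (fsbigTE (fset_set A)); first exact/esym/big_mkcond.
move=> x; rewrite in_fset_set// => /negP xA; rewrite /patch; case: ifPn => // Px.
by apply: contrapT => Fx; apply: xA; apply/mem_set; apply: supp => //; exact: set_mem.
Qed.

Lemma fsum_sum (J : finType) (V : nmodType) (A P : set T) (F : J -> T -> V) :
  finite_set A -> (forall j x, P x -> F j x <> 0 -> A x) ->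
  \sum_(x \in P) \sum_j F j x = \sum_j \sum_(x \in P) F j x.
Proof.
move=> finA supp; rewrite (fsumE finA); last first.
  move=> x Px; apply: contra_notP => Ax; apply: big1 => j _.
  by apply: contrapT => Fj; apply: Ax; apply: supp Fj.
rewrite exchange_big; apply: eq_bigr => j _; rewrite (fsumE finA)// => x; exact: supp.
Qed.

Lemma fsumD (V : nmodType) (A P : set T) (F G : T -> V) : finite_set A ->
  (forall x, P x -> F x <> 0 -> A x) -> (forall x, P x -> G x <> 0 -> A x) ->
  \sum_(x \in P) (F x + G x) = \sum_(x \in P) F x + \sum_(x \in P) G x.
Proof.
move=> finA suppF suppG.
have -> : \sum_(x \in P) (F x + G x) = \sum_(x \in P) \sum_(b : bool) (if b then F x else G x).
  by apply: eq_fsbigr => x _; rewrite big_bool.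
by rewrite (fsum_sum finA) ?big_bool// => -[] x; [exact: suppF|exact: suppG].
Qed.

Lemma lin_fsum (K : pzRingType) (U W : lmodType K) (f : U -> W) (A P : set T) (F : T -> U) :
  linear f -> finite_set A -> (forall x, P x -> F x <> 0 -> A x) ->
  f (\sum_(x \in P) F x) = \sum_(x \in P) f (F x).
Proof.
move=> fl finA supp; rewrite (fsumE finA)// (fsumE finA) ?lin_sum// => x Px.
by move=> fFx; apply: supp => // Fx0; apply: fFx; rewrite Fx0 lin0.
Qed.

(** An infinite support is covered by [Q 0], since the sum is then 0. *)
Lemma fsum_closed (V : nmodType) (Q : V -> Prop) (P : set T) (F : T -> V) :
  Q 0 -> (forall x y, Q x -> Q y -> Q (x + y)) -> (forall x, P x -> Q (F x)) ->
  Q (\sum_(x \in P) F x).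
Proof.
move=> Q0 QD QF; rewrite big_seq_cond; elim/big_rec: _ => // x y /andP[+ _] Qy.
by case: finite_supportP => // X XP _ _ xX; apply: QD => //; apply/QF/XP.
Qed.
End FiniteSupport.

(** * Leibniz rule for formal series *)

Section Derivation.
Local Open Scope classical_set_scope.
Variables (K : numFieldType) (I : nmodType) (J : finType).
Variables (w : J -> I -> K) (s : J -> I).

(* A sum of elementary derivations such as ∂_z and z^-1 ∂_ζ: w j is the exponent
   brought down by the j-th one, and s j is minus its degree.  Since exponents of
   ζ are natural numbers, p - s j need not exist; w_supp below says that it does
   whenever p has a nonzero weight. *)
Definition der (U : lmodType K) (f : I -> U) : I -> U :=
  fun e => \sum_j w j (e + s j) *: f (e + s j).

Hypothesis wD : forall j p q, w j (p + q) = w j p + w j q.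
Hypothesis s_inj : forall j, injective (fun p => p + s j).
Hypothesis w_supp : forall j p, w j p != 0 -> exists p', p = p' + s j.

(** Finite support at each exponent keeps [fapp] away from its default value 0. *)
Definition summable (U W : lmodType K) (Phi : I -> U -> W) (G : I -> U) :=
  forall e, finite_set [set p : I * I | p.1 + p.2 = e /\ Phi p.1 (G p.2) <> 0].

Variables (U W : lmodType K) (Phi : I -> U -> W) (G : I -> U).
Hypothesis Phil : forall p, linear (Phi p).
Hypothesis finPhiG : summable Phi G.

(** Reindexing by [p.1 + s j]. The pairs missed are those whose first exponent is not of the form
    [p' + s j]; their weight is zero by [w_supp]. *)
Lemma fapp_shiftl j e :
  \sum_(p \in [set p : I * I | p.1 + p.2 = e + s j]) w j p.1 *: Phi p.1 (G p.2) =
  \sum_(p \in [set p : I * I | p.1 + p.2 = e])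
     w j (p.1 + s j) *: Phi (p.1 + s j) (G p.2).
Proof.
pose h (p : I * I) := (p.1 + s j, p.2).
have hinj : set_inj [set p : I * I | p.1 + p.2 = e] h.
  by move=> [p1 p2] [q1 q2] _ _ [/s_inj -> ->].
rewrite -[RHS](@fsbig_image _ _ _ _ _ _ h (fun p => w j p.1 *: Phi p.1 (G p.2)) hinj).
apply/esym/fsbig_widen => [_ [[p q] /= <- <-]|[p q] [/= pq hpq]] /=.
  by rewrite addrAC.
apply: contrapT => /eqP; rewrite scaler_eq0 negb_or => /andP[/w_supp[p' pp'] _].
apply: hpq; exists (p', q) => //=; last by rewrite /h /= pp'.
by apply: (@s_inj j); rewrite -pq pp' addrAC.
Qed.

Lemma fapp_shiftr j e :
  \sum_(p \in [set p : I * I | p.1 + p.2 = e + s j]) w j p.2 *: Phi p.1 (G p.2) =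
  \sum_(p \in [set p : I * I | p.1 + p.2 = e])
     w j (p.2 + s j) *: Phi p.1 (G (p.2 + s j)).
Proof.
pose h (p : I * I) := (p.1, p.2 + s j).
have hinj : set_inj [set p : I * I | p.1 + p.2 = e] h.
  by move=> [p1 p2] [q1 q2] _ _ [-> /s_inj ->].
rewrite -[RHS](@fsbig_image _ _ _ _ _ _ h (fun p => w j p.2 *: Phi p.1 (G p.2)) hinj).
apply/esym/fsbig_widen => [_ [[p q] /= <- <-]|[p q] [/= pq hpq]] /=.
  by rewrite addrA.
apply: contrapT => /eqP; rewrite scaler_eq0 negb_or => /andP[/w_supp[q' qq'] _].
apply: hpq; exists (p, q') => //=; last by rewrite /h /= qq'.
by apply: (@s_inj j); rewrite -pq qq' addrA.
Qed.

Let supp e j (h : I * I -> I * I) := [set p : I * I | p.1 + p.2 = e /\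
  ((h p).1 + (h p).2 = e + s j /\ Phi (h p).1 (G (h p).2) <> 0)].

Lemma fin_supp_shift e (h : J -> I * I -> I * I) : (forall j, injective (h j)) ->
  finite_set (\bigcup_(j in [set: J]) supp e j (h j)).
Proof.
move=> hinj; apply: bigcup_finite => [|j _]; first exact: finite_finset.
apply: (@sub_finite_set _ _ (h j @^-1` [set p : I * I | p.1 + p.2 = e + s j /\
    Phi p.1 (G p.2) <> 0])); first by move=> p [_ [h1 h2]].
by apply: finite_preimage (finPhiG _) => p q _ _; exact: hinj.
Qed.

(** By [wD] the weight of [p.1 + p.2] splits into the weights of [p.1] and of [p.2], and each half
    is reindexed by its own shift. *)
Lemma der_fapp e : der (fapp Phi G) e =
  fapp (fun p u => der (Phi ^~ u) p) G e + fapp Phi (der G) e.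
Proof.
pose hl j (p : I * I) := (p.1 + s j, p.2); pose hr j (p : I * I) := (p.1, p.2 + s j).
have hlinj j : injective (hl j) by move=> [p1 p2] [q1 q2] [/s_inj -> ->].
have hrinj j : injective (hr j) by move=> [p1 p2] [q1 q2] [-> /s_inj ->].
have -> : der (fapp Phi G) e = \sum_j (\sum_(p \in [set p : I * I | p.1 + p.2 = e])
     w j (p.1 + s j) *: Phi (p.1 + s j) (G p.2) +
   \sum_(p \in [set p : I * I | p.1 + p.2 = e])
     w j (p.2 + s j) *: Phi p.1 (G (p.2 + s j))).
  apply: eq_bigr => j _; rewrite -fapp_shiftl -fapp_shiftr /fapp.
  have fin := finPhiG (e + s j).
  have Zl : linear (fun x : W => w j (e + s j) *: x).
    by move=> k x y; rewrite scalerDr !scalerA mulrC.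
  rewrite (lin_fsum Zl fin)//.
  rewrite -(fsumD fin); last first.
  - by move=> p pe ne; split=> // h0; apply: ne; rewrite h0 scaler0.
  - by move=> p pe ne; split=> // h0; apply: ne; rewrite h0 scaler0.
  by apply: eq_fsbigr => p /set_mem <-; rewrite wD scalerDl.
(* Bringing the sum over [j] inside needs one finite set for all shifts, namely the union from
   [fin_supp_shift]. *)
rewrite big_split /=; congr (_ + _).
  rewrite -(fsum_sum (fin_supp_shift e hlinj))// => j p pe ne; exists j => //.
  split=> //; split; first by rewrite /= addrAC pe.
  by move=> h0; apply: ne; rewrite h0 scaler0.
rewrite -(fsum_sum (fin_supp_shift e hrinj)); last first.
  move=> j p pe ne; exists j => //; split=> //; split; first by rewrite /= addrA pe.
  by move=> h0; apply: ne; rewrite h0 scaler0.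
apply: eq_fsbigr => p _; rewrite /der lin_sum//.
by apply: eq_bigr => j _; rewrite linZ.
Qed.
End Derivation.

(** * Series in two variables, their derivation and their supports *)

Section TwoVariables.
Local Open Scope classical_set_scope.
Variable K : numFieldType.
Local Notation I := (expo * expo)%type.

Lemma expo2_eq (p q : I) : p.1.1 = q.1.1 -> p.1.2 = q.1.2 ->
  p.2.1 = q.2.1 -> p.2.2 = q.2.2 -> p = q.
Proof. by case: p q => -[a b] [c d] [[a' b'] [c' d']] /= -> -> -> ->. Qed.

Lemma expo2_add_eq (p q e : I) : p + q = e ->
  [/\ p.1.1 + q.1.1 = e.1.1, (p.1.2 + q.1.2)%N = e.1.2,
      p.2.1 + q.2.1 = e.2.1 & (p.2.2 + q.2.2)%N = e.2.2].
Proof. by move=> <-. Qed.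

(** The index [j] says which variable is meant ([j.1] true for the second) and whether the piece is
    z^-1 ∂_ζ ([j.2] true) or ∂_z; both pieces lower the exponent of z by one, as [Ds] records. *)
Definition Dw (j : bool * bool) (e : I) : K :=
  let x := if j.1 then e.2 else e.1 in if j.2 then x.2%:R else x.1%:~R.
Definition Ds (j : bool * bool) : I :=
  let u : expo := (1, nat_of_bool j.2) in if j.1 then (0, u) else (u, 0).

Lemma Dw_add j p q : Dw j (p + q) = Dw j p + Dw j q.
Proof. by case: j => [[] []]; rewrite /Dw /= ?rmorphD //= natrD. Qed.

Lemma Ds_inj j : injective (fun p => p + Ds j).
Proof.
by case: j => [[] []] [[a b] [c d]] [[a' b'] [c' d']] [] => h1 h2 h3 h4;
  apply: expo2_eq => /=; lia.
Qed.

Lemma Dw_supp j p : Dw j p != 0 -> exists p', p = p' + Ds j.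
Proof.
case: j p => [[] []] [[a b] [c d]]; rewrite /Dw /Ds /= => nz.
- case: d nz => [|d] nz; first by rewrite mulr0n eqxx in nz.
  by exists ((a, b), (c - 1, d)); apply: expo2_eq => /=; lia.
- by exists ((a, b), (c - 1, d)); apply: expo2_eq => /=; lia.
- case: b nz => [|b] nz; first by rewrite mulr0n eqxx in nz.
  by exists ((a - 1, b), (c, d)); apply: expo2_eq => /=; lia.
- by exists ((a - 1, b), (c, d)); apply: expo2_eq => /=; lia.
Qed.

Definition D12 (U : lmodType K) := @der K I _ Dw Ds U.

Lemma D12E (U : lmodType K) (f : I -> U) e :
  D12 f e = Dz (fun x => f (x, e.2)) e.1 + Dz (fun x => f (e.1, x)) e.2.
Proof.
rewrite /D12 /der -(pair_bigA _ (fun a b => Dw (a, b) (e + Ds (a, b)) *: f (e + Ds (a, b)))) /=.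
rewrite !big_bool /= /Dz /Dw /Ds /= addrC; case: e => -[a b] [c d] /=.
congr (_ + _); rewrite addrC; congr (_ *: _ + _ *: _).
all: try by apply: (congr1 (fun k => k%:R)); lia.
all: by apply: (congr1 f); apply: expo2_eq => /=; lia.
Qed.

(* The exponents occurring in z12^N ϑ12^k: total degree d in (z1, z2), no
   negative power of z2, no ζ2, bounded degree in ζ1.  Paired with a series
   without negative powers of z2, finitely many of them contribute to each
   coefficient. *)
Definition homog (d : int) (M : nat) (q : I) : Prop :=
  [/\ q.2.2 = 0%N, (q.1.2 <= M)%N, 0 <= q.2.1 & q.1.1 + q.2.1 = d].

Definition supported (U : lmodType K) (A : set I) (G : I -> U) :=
  forall q, G q <> 0 -> A q.

Lemma fapp_neq0 (U W : lmodType K) (Phi : I -> U -> W) (G : I -> U) e :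
  fapp Phi G e <> 0 -> exists p q, p + q = e /\ Phi p (G q) <> 0.
Proof.
move=> ne; apply: contrapT => none; apply: ne; apply: fsbig1 => -[p q] /= pq.
by apply: contrapT => h; apply: none; exists p, q.
Qed.

Section Fapp.
Variables (U W : lmodType K) (Phi : I -> U -> W) (G : I -> U) (d : int) (M : nat).
Hypothesis Phil : forall p, linear (Phi p).
Hypothesis PhiG : forall p q, Phi p (G q) <> 0 -> 0 <= p.2.1.
Hypothesis Gsupp : supported (homog d M) G.

Lemma supp_arg p q : Phi p (G q) <> 0 -> homog d M q.
Proof. by move=> ne; apply: Gsupp => G0; apply: ne; rewrite G0 lin0. Qed.

(** For a fixed total exponent, a contributing [q] is determined by its exponents of ζ1 and z2. The
    first is at most [M]; the second is bounded on both sides because [p] has no negative power of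
    z2 either. *)
Lemma homog_summable : summable Phi G.
Proof.
move=> [[a b] [c f]]; pose h (x : nat * nat) : I * I :=
  let q : I := ((d - x.2%:Z, x.1), (x.2%:Z, 0%N)) in
  (((a - q.1.1, (b - q.1.2)%N), (c - q.2.1, f)), q).
apply: (@sub_finite_set _ _ (h @` (`I_M.+1 `*` `I_`|c|.+1))); last first.
  exact/finite_image/finite_setX.
move=> [p q] /= [pq ne]; have [q22 q12 q21 qd] := supp_arg ne.
have p21 := PhiG ne; exists (q.1.2, `|q.2.1|%N) => /=; first by
  split=> /=; move/expo2_add_eq: pq => [] /=; lia.
by rewrite /h /=; congr (_, _); apply: expo2_eq; move/expo2_add_eq: pq => [] /=; lia.
Qed.

(** At exponent 0 of z2, two nonnegative exponents of z2 add up to 0 and hence both vanish; so [q]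
    has z1-exponent [d] and only its ζ1-exponent is free. *)
Lemma fapp_at0 n i : fapp Phi G ((n, i), 0) =
  \sum_(k < i.+1) Phi ((n - d, (i - k)%N), 0) (G ((d, nat_of_ord k), 0)).
Proof.
pose h (k : nat) : I * I := (((n - d, (i - k)%N), 0), ((d, k), 0)).
rewrite -(big_mkord xpredT (fun k => Phi (h k).1 (G (h k).2))) /index_iota subn0.
rewrite -(big_map h xpredT (fun p => Phi p.1 (G p.2))) /fapp.
set r := map h _.
have rE p : p \in r -> exists2 k, (k < i.+1)%N & p = h k.
  by case/seq.mapP => k; rewrite mem_iota => ki ->; exists k.
have hr k : (k < i.+1)%N -> h k \in r by move=> ki; apply: map_f; rewrite mem_iota.
have hE k : (k < i.+1)%N -> (h k).1 + (h k).2 = ((n, i), 0).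
  by move=> ki; apply: expo2_eq; rewrite /h /=; lia.
rewrite (fsbigE r) ?map_inj_uniq ?iota_uniq//; last 3 first.
- by move=> k l [].
- by move=> _ /rE[k + ->]; exact: hE.
- move=> [p q] pq /negP notin; apply: contrapT => ne; apply: notin.
  have := supp_arg ne; have := PhiG ne; move=> /= p21 [q22 q12 q21 qd].
  suff -> : (p, q) = h q.1.2 by apply: hr; move/expo2_add_eq: pq => [] /=; lia.
  by rewrite /h; congr (_, _); apply: expo2_eq; move/expo2_add_eq: pq => [] /=; lia.
rewrite big_seq_cond [RHS]big_seq; apply: eq_bigl => p.
by apply: andb_idr => /rE[k + ->] => /hE hk; apply/mem_set.
Qed.
End Fapp.

Section Fscale.
Variable (U : lmodType K).
Implicit Types (g : I -> K) (G : I -> U).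

Lemma scale_lin g p : linear (fun v : U => g p *: v).
Proof. by move=> k x y; rewrite scalerDr !scalerA mulrC. Qed.

Lemma fscale_pos g G d M : supported (homog d M) (g : I -> K^o) ->
  forall p q, g p *: G q <> 0 -> 0 <= p.2.1.
Proof.
move=> gs p q ne; have [] // := gs p.
by move=> g0; apply: ne; rewrite g0 scale0r.
Qed.

Lemma fscale_supported g G d M d' M' : supported (homog d M) (g : I -> K^o) ->
  supported (homog d' M') G -> supported (homog (d + d') (M + M')) (fscale g G).
Proof.
move=> gs Gs e /fapp_neq0[p [q [<- ne]]].
have [|p1 p2 p3 p4] := gs p; first by move=> g0; apply: ne; rewrite g0 scale0r.
have [|q1 q2 q3 q4] := Gs q; first by move=> g0; apply: ne; rewrite g0 scaler0.
by split=> /=; lia.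
Qed.

Lemma fscale_at0 g G d M d' M' n i : supported (homog d M) (g : I -> K^o) ->
  supported (homog d' M') G -> fscale g G ((n, i), 0) =
  \sum_(k < i.+1) g ((n - d', (i - k)%N), 0) *: G ((d', nat_of_ord k), 0).
Proof.
by move=> gs Gs; apply: fapp_at0 Gs _ _; [exact: scale_lin|exact: fscale_pos gs].
Qed.

Lemma D12_fscale g G d M d' M' : supported (homog d M) (g : I -> K^o) ->
  supported (homog d' M') G ->
  D12 (g : I -> K^o) =1 (fun=> 0) -> D12 G =1 (fun=> 0) -> D12 (fscale g G) =1 (fun=> 0).
Proof.
move=> gs Gs Dg DG e; rewrite /D12 /fscale der_fapp; last first.
- by apply: homog_summable Gs; [exact: scale_lin|exact: fscale_pos gs].
- exact: scale_lin.
- exact: Dw_supp.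
- exact: Ds_inj.
- exact: Dw_add.
rewrite /fapp fsbig1 => [|[p q] /= _]; last first.
  have := Dg p; rewrite /D12 /der => Dgp.
  by under eq_bigr do rewrite scalerA; rewrite -scaler_suml [X in X *: _]Dgp scale0r.
rewrite add0r fsbig1// => -[p q] /= _.
by have := DG q; rewrite /D12 => ->; rewrite scaler0.
Qed.
End Fscale.
End TwoVariables.

(** * The kernels z12 and ϑ12 *)

Section Kernels.
Local Open Scope classical_set_scope.
Variable K : numFieldType.
Local Notation I := (expo * expo)%type.
Local Notation series g := (g : I -> K^o).

Lemma homogS d M M' : (M <= M')%N -> homog d M `<=` homog d M'.
Proof. by move=> MM q [q1 q2 q3 q4]; split=> //; exact: leq_trans MM. Qed.

Lemma z12_supported : supported (homog 1 0) (series (z12 K)).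
Proof.
move=> e; rewrite /z12; case: eqP => [->|_] //; case: eqP => [->|_] //.
by rewrite subrr.
Qed.

Lemma theta12_supported : supported (homog 0 1) (series (theta12 K)).
Proof.
move=> [[m i] [n j]]; rewrite /theta12; case: eqP => [[-> -> -> ->]|_] //.
case: ifP; last by rewrite subrr.
by move=> /and4P[/eqP -> /eqP -> n0 /eqP ->] _; split=> //=; lia.
Qed.

Lemma one_supported : supported (homog 0 0) (series (fun e => (e == 0)%:R)).
Proof. by move=> e; case: eqP => [->|]. Qed.

Lemma fpow_supported (g : I -> K) d M k : supported (homog d M) (series g) ->
  supported (homog (k%:Z * d) (k * M)) (series (fpow g k)).
Proof.
move=> gs; elim: k => [|k ih]; first by rewrite mul0r; exact: one_supported.
have -> : k.+1%:Z * d = d + k%:Z * d by lia.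
rewrite mulSn; exact: fscale_supported gs ih.
Qed.

Lemma fpow_z12_supported (N : nat) : supported (homog N%:Z 0) (series (fpow (z12 K) N)).
Proof. by have := fpow_supported (k := N) z12_supported; rewrite mulr1 muln0. Qed.

Lemma fpow_theta12_supported k : supported (homog 0 k) (series (fpow (theta12 K) k)).
Proof. by have := fpow_supported (k := k) theta12_supported; rewrite mulr0 muln1. Qed.

Lemma D12_one : D12 (series (fun e => (e == 0)%:R)) =1 (fun=> 0).
Proof.
move=> e; rewrite /D12 /der big1// => -[a b] _; case: eqP => [->|]; last by rewrite scaler0.
by rewrite /Dw; case: a b => [] []; rewrite scale0r.
Qed.

Lemma D12_z12 : D12 (series (z12 K)) =1 (fun=> 0).
Proof.
move=> [[m i] [n j]]; rewrite D12E /Dz /z12 /=.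
rewrite !xpair_eqE.
have -> : (m + 1 == 1) = (m == 0) by lia.
have -> : (n + 1 == 1) = (n == 0) by lia.
have -> : (m + 1 == 0) = (m == -1) by lia.
have -> : (n + 1 == 0) = (n == -1) by lia.
rewrite /GRing.scale /= !andbF !andbA.
case: (eqVneq m (-1)) => [->|_] /=; case: (eqVneq n (-1)) => [->|_] /=;
  rewrite ?andbF /= ?addNr; try ring.
case: (eqVneq m 0) => [->|_] /=; last by ring.
case: (eqVneq n 0) => [->|_]; rewrite ?andbF /= ?add0r; ring.
Qed.

(** ϑ12 is the expansion of log(z1 - z2): the derivatives of its tail telescope to -z1^-1, which
    cancels D_z1 ζ1. *)
Lemma D12_theta12 : D12 (series (theta12 K)) =1 (fun=> 0).
Proof.
move=> [[m i] [n j]]; rewrite D12E /Dz /theta12 /= !xpair_eqE.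
have -> : (m + 1 == 0) = (m == -1) by lia.
have -> : (n + 1 == 0) = (n == -1) by lia.
have -> : (m + 1 == - n) = (m == -1 - n) by lia.
have -> : (m == - (n + 1)) = (m == -1 - n) by lia.
have -> : (0 < n + 1) = (0 < n) || (n == 0) by lia.
rewrite eqSS /GRing.scale /= !andbF.
case: (eqVneq j 0%N) => [_|j0]; last by rewrite !andbF /=; ring.
case: (eqVneq i 0%N) => [->|i0] /=; last first.
  rewrite !andbF /= !andbT.
  case: (eqVneq m (-1)) => [->|_] /=; case: (eqVneq n (-1)) => [->|_] /=;
  rewrite ?andbF /= ?addNr; try ring.
rewrite !andbF !andbT.
case: (eqVneq m (-1 - n)) => [->|h]; last first.
  case: (eqVneq n 0) h => [->|n0 h]; last by rewrite /= ?andbF /=; ring.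
  by rewrite subr0 => /negPf ->; rewrite /= ?andbF /=; ring.
rewrite !andbT.
(* At [n] = 0 the term from ζ1 meets the first term of the tail; for [n] > 0 the two derivatives of
   the tail cancel. *)
case: (eqVneq n 0) => [->|n0] /=; first by rewrite /=; field.
rewrite !andbF orbF /=; case: ifP => [n1|_]; last by ring.
have n0' : n%:~R != 0 :> K by rewrite intr_eq0.
have n1' : (n + 1)%:~R != 0 :> K by rewrite intr_eq0; lia.
have -> : (-1 - n + 1) = - n by lia.
by rewrite rmorphN /= !sub0r mulrNN !mulrN !mulfV//; ring.
Qed.

Lemma D12_fpow (g : I -> K) d M k : supported (homog d M) (series g) ->
  D12 (series g) =1 (fun=> 0) -> D12 (series (fpow g k)) =1 (fun=> 0).
Proof.
move=> gs Dg; elim: k => [|k ih]; first exact: D12_one.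
exact: D12_fscale gs (fpow_supported (k := k) gs) Dg ih.
Qed.

Lemma fpow_z12_at0 (N : nat) : fpow (z12 K) N ((N%:Z, 0%N), 0) = 1.
Proof.
elim: N => [|N ih] //=.
rewrite (fscale_at0 _ _ z12_supported (@fpow_z12_supported N)) big_ord1 /= ih.
have -> : N.+1%:Z - N%:Z = 1 by lia.
by rewrite /GRing.scale /= mulr1 /z12 /= subr0.
Qed.

(** At z2 = 0 the tail of ϑ12 disappears and only ζ1 is left. *)
Lemma fpow_theta12_at0 k i : fpow (theta12 K) k ((0, i), 0) = (i == k)%:R.
Proof.
elim: k i => [|k ih] i; first by rewrite /= !xpair_eqE /= andbT.
rewrite /= (fscale_at0 _ _ theta12_supported (@fpow_theta12_supported k)).
have th l : theta12 K ((0 - 0, l), 0) = (l == 1%N)%:R.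
  by rewrite /theta12 /= andbF !subr0 !xpair_eqE /= andbT.
under eq_bigr => l _ do rewrite ih th.
case: i => [|i]; first by rewrite big_ord1 /= scale0r.
rewrite (bigD1 (Ordinal (ltnW (ltnSn i.+1)))) //= big1 => [|l /eqP li].
  by rewrite addr0 subSnn scale1r eqSS.
rewrite (_ : (_ == 1)%N = false) ?scale0r//.
apply/negP => /eqP h; apply: li; apply: val_inj => /=; have := ltn_ord l; lia.
Qed.

Definition eswap (e : I) : I := (e.2, e.1).

Lemma fapp_eswap (U W : lmodType K) (Phi : I -> U -> W) G e :
  fapp (Phi \o eswap) (G \o eswap) e = fapp Phi G (eswap e).
Proof.
pose h (p : I * I) := (eswap p.1, eswap p.2).
rewrite /fapp; apply/esym/(@reindex_fsbig _ _ _ _ _ h _ _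
  (fun p => Phi p.1 (G p.2))); split.
- by move=> p /= <-.
- by move=> [[p1 p2] [q1 q2]] [[p1' p2'] [q1' q2']] _ _ [-> -> -> ->].
- move=> p /= pe; exists (h p); last by case: p {pe} => -[? ?] [].
  by rewrite /h /=; have := congr1 eswap pe; case: e {pe}.
Qed.

Lemma fscale_eswap (U : lmodType K) (g : I -> K) (G : I -> U) :
  fscale (g \o eswap) (G \o eswap) = fscale g G \o eswap.
Proof. by apply/funext => e; exact: (fapp_eswap (fun e v => g e *: v)). Qed.

Lemma fpow_eswap (g : I -> K) k : fpow (g \o eswap) k = fpow g k \o eswap.
Proof.
elim: k => [|k ih] /=; last by rewrite ih fscale_eswap.
by apply/funext => -[e1 e2] /=; rewrite !xpair_eqE andbC.
Qed.

Lemma z12_eswap e : z12 K (eswap e) = - z12 K e.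
Proof.
rewrite /z12 opprB; case: e => e1 e2; rewrite /eswap /= !xpair_eqE.
by congr (_ - _); rewrite andbC.
Qed.

Lemma fpow_z12_eswap N e : fpow (z12 K) N (eswap e) = (-1) ^+ N * fpow (z12 K) N e.
Proof.
rewrite -[LHS]/((fpow (z12 K) N \o eswap) e) -fpow_eswap.
elim: N e => [|N ih] e /=; first by rewrite mul1r.
have -> : fpow (z12 K \o eswap) N = (fun e => (-1) ^+ N *: (fpow (z12 K) N e : K^o)).
  by apply/funext => p; rewrite ih.
rewrite {1}/fscale /fapp /=.
(* Pulling the sign out of the sum requires finite support. *)
have fin := @homog_summable K K^o K^o (fun e v => z12 K e *: v) (fpow (z12 K) N) N 0
  (@scale_lin K K^o (z12 K)) (fscale_pos (U := K^o) (G := fpow (z12 K) N) z12_supported)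
  (@fpow_z12_supported N).
rewrite -[RHS]/((-1) ^+ N.+1 *: (_ : K^o)) /= /fscale /fapp.
rewrite (lin_fsum (f := fun x : K^o => (-1) ^+ N.+1 *: x) _ (fin e))//; last first.
  by move=> k x y; rewrite scalerDr !scalerA mulrC.
apply: eq_fsbigr => -[p q] _ /=; rewrite z12_eswap exprS /GRing.scale /=; ring.
Qed.
End Kernels.

(** * The locality series *)

Section TensorLinear.
Variables (K : comNzRingType).
Implicit Types U V W : lmodType K.

Lemma tmap_pure U V U' V' (f : U -> U') (g : V -> V') a b : linear f -> linear g ->
  tmap f g (a ⊗ b) = f a ⊗ g b.
Proof.
move=> fl gl; apply: tlift_pure => [c k x y|c k x y]; rewrite ?fl ?gl.
  exact: tpure_linl.
exact: tpure_linr.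
Qed.

Lemma tmap_linear U V U' V' (f : U -> U') (g : V -> V') : linear f -> linear g ->
  linear (tmap f g).
Proof.
move=> fl gl; apply: tlift_linear => [c k x y|c k x y]; rewrite ?fl ?gl.
  exact: tpure_linl.
exact: tpure_linr.
Qed.

Let assoc_linl U V W (c : W) (a : U) : linear (fun b : V => a ⊗ (b ⊗ c)).
Proof. by move=> k x y; rewrite tpure_linl tpure_linr. Qed.

Let assoc_linr U V W (c : W) (b : V) : linear (fun a : U => a ⊗ (b ⊗ c)).
Proof. exact: tpure_linl. Qed.

Let assoc_lin U V W (x : tens U V) :
  linear (fun c : W => tlift (fun a b => a ⊗ (b ⊗ c)) x).
Proof.
move=> k c c'; rewrite /tlift scaler_sumr -big_split; apply: eq_bigr => p _.
by rewrite tpure_linr tpure_linr.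
Qed.

Lemma tassoc_pure U V W (a : U) (b : V) (c : W) : tassoc (a ⊗ b ⊗ c) = a ⊗ (b ⊗ c).
Proof.
rewrite /tassoc tlift_pure ?(tlift_pure (assoc_linr c) (assoc_linl c))// => d.
exact: tlift_linear (assoc_linr d) (assoc_linl d).
Qed.

Lemma tassoc_linear U V W : linear (@tassoc K U V W).
Proof.
apply: tlift_linear => [c|x]; last exact: assoc_lin.
exact: tlift_linear (assoc_linr c) (assoc_linl c).
Qed.

Lemma tens_lin_eq U V W (f g : tens U V -> W) : linear f -> linear g ->
  (forall a b, f (a ⊗ b) = g (a ⊗ b)) -> f =1 g.
Proof.
move=> fl gl fg x; rewrite (tens_decomp x) !lin_sum//.
by apply: eq_bigr => p _.
Qed.
End TensorLinear.

(** * Exponentials of nilpotent operators *)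

Section Exponential.
Local Open Scope classical_set_scope.
Variables (K : numFieldType) (U : lmodType K) (A : U -> U) (x : U) (M : nat).
Hypothesis nilp : forall k, (M <= k)%N -> iter k A x = 0.
Local Notation I := (expo * expo)%type.

Lemma fexp_opE (theta : I -> K) e : fexp_op theta A x e =
  \sum_(k < M) ((k`!%:R)^-1 * fpow theta k e) *: iter k A x.
Proof.
rewrite (fsbig_ord _ _ (fun k => ((k`!%:R)^-1 * fpow theta k e) *: iter k A x)).
apply/esym/fsbig_widen => // k [_ /= kM].
by rewrite nilp ?scaler0//; move/negP: kM; rewrite -leqNgt.
Qed.

Lemma fexp_supported : supported (homog 0 M) (fexp_op (theta12 K) A x).
Proof.
move=> e; rewrite fexp_opE => ne; apply: contrapT => he; apply: ne.
apply: big1 => k _; rewrite (_ : fpow _ _ _ = 0) ?mulr0 ?scale0r//.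
apply: contrapT => /fpow_theta12_supported; apply: contra_not he.
exact/homogS/ltnW/ltn_ord.
Qed.

Lemma D12_fexp : D12 (fexp_op (theta12 K) A x) =1 (fun=> 0).
Proof.
move=> e; rewrite /D12 /der.
under eq_bigr do rewrite fexp_opE scaler_sumr.
rewrite exchange_big big1//= => k _.
have := @D12_fpow K _ _ _ k (@theta12_supported K) (@D12_theta12 K) e.
rewrite /D12 /der => Dk.
under eq_bigr do rewrite scalerA mulrCA -scalerA.
by rewrite -scaler_sumr -scaler_suml [X in _ *: (X *: _)]Dk scale0r scaler0.
Qed.

Lemma fexp_at0 i : fexp_op (theta12 K) A x ((0, i), 0) = (i`!%:R)^-1 *: iter i A x.
Proof.
rewrite fexp_opE; under eq_bigr do rewrite fpow_theta12_at0.
have [iM|Mi] := ltnP i M.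
  rewrite (bigD1 (Ordinal iM)) //= eqxx mulr1 big1 ?addr0// => k /eqP ki.
  rewrite (_ : (i == k) = false) ?mulr0 ?scale0r//.
  by apply/eqP => ik; apply: ki; apply: val_inj.
rewrite nilp// scaler0 big1// => k _; rewrite gtn_eqF ?mulr0 ?scale0r//.
exact: leq_trans (ltn_ord k) Mi.
Qed.
End Exponential.

Lemma fexp_opZ (K : numFieldType) (U : lmodType K) (A : U -> U) x M theta c e :
  linear A -> (forall k, (M <= k)%N -> iter k A x = 0) ->
  fexp_op theta A (c *: x) e = c *: fexp_op theta A x e.
Proof.
move=> Al nilp; have iterZ k : iter k A (c *: x) = c *: iter k A x.
  by elim: k => //= k ->; rewrite linZ.
rewrite (fexp_opE nilp) (fexp_opE (M := M)) => [|k /nilp h]; last by rewrite iterZ h scaler0.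
by rewrite scaler_sumr; apply: eq_bigr => k _; rewrite iterZ !scalerA mulrC.
Qed.

Lemma fexp_op_eswap (K : numFieldType) (U : lmodType K) (A : U -> U) x e :
  fexp_op (theta21 K) A x e = fexp_op (theta12 K) A x (eswap e).
Proof.
apply: eq_fsbigr => k _; congr (_ * _ *: _).
exact: (congr1 (fun g => g e) (fpow_eswap (theta12 K) k)).
Qed.

(** * Products of two fields applied to the vacuum *)

Section LogVA.
Local Open Scope classical_set_scope.
Variables (K : numFieldType) (V : superspace K) (A : logVA V).
Local Notation I := (expo * expo)%type.
Local Notation Y := (logva_Y A).
Local Notation S := (logva_S A).
Local Notation T := (logva_T A).
Local Notation vac := (logva_vac A).

Lemma logva_Y_lin1 b e : linear (fun a => Y a b e).
Proof. by move=> k x y; rewrite (logva_Y_linl A b). Qed.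

Lemma logva_Y_lin2 a e : linear (fun b => Y a b e).
Proof. by move=> k x y; rewrite (logva_Y_linr A a). Qed.

Lemma Yten_pure e a b : Yten Y e (a ⊗ b) = Y a b e.
Proof. by apply: tlift_pure => c; [exact: logva_Y_lin1|exact: logva_Y_lin2]. Qed.

Lemma Yten_linear e : linear (Yten Y e).
Proof. by apply: tlift_linear => c; [exact: logva_Y_lin1|exact: logva_Y_lin2]. Qed.

Lemma id_linear (U : lmodType K) : linear (@id U).
Proof. by []. Qed.

Lemma YY12_linear e : linear (YY12 Y e).
Proof.
move=> k x y; rewrite /YY12 /= tassoc_linear.
by rewrite (tmap_linear (@id_linear _) (Yten_linear _)) Yten_linear.
Qed.

Lemma YY12_pure e a b c : YY12 Y e (a ⊗ b ⊗ c) = Y a (Y b c e.2) e.1.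
Proof.
rewrite /YY12 /= tassoc_pure (tmap_pure _ _ (@id_linear _) (Yten_linear _)).
by rewrite !Yten_pure.
Qed.

Lemma YY12_linearl e c : linear (fun x : tens V V => YY12 Y e (x ⊗ c)).
Proof. by move=> k x y; rewrite (tpure_linl c) YY12_linear. Qed.

Lemma YY12_vac0 e x : (e.2.1 < 0) || (0 < e.2.2)%N -> YY12 Y e (x ⊗ vac) = 0.
Proof.
move=> he; apply: (tens_lin_eq (YY12_linearl e vac) (g := fun=> 0)) x => [|a b].
  by move=> k x y; rewrite scaler0 addr0.
rewrite YY12_pure; case: e he => e1 [n i] /= he.
by rewrite (logva_vacuum_right_regular A)// (lin0 (logva_Y_lin2 _ _)).
Qed.

Lemma YY12_vac_value e1 x : YY12 Y (e1, 0) (x ⊗ vac) = Yten Y e1 x.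
Proof.
apply: (tens_lin_eq (YY12_linearl _ _) (Yten_linear _)) x => a b.
by rewrite YY12_pure Yten_pure /= (logva_vacuum_right_value A).
Qed.

Lemma T_linear : linear T.
Proof. exact: linearP. Qed.

(** Covariance turns D_z1 into [T, Y(a)] and D_z2 into [T, Y(b)]; the two middle terms cancel and T
    vac = 0 kills the last one. *)
Lemma D12_YY12_vac e x :
  D12 (fun e' => YY12 Y e' (x ⊗ vac)) e = T (YY12 Y e (x ⊗ vac)).
Proof.
apply: (tens_lin_eq (f := fun x => D12 (fun e' => YY12 Y e' (x ⊗ vac)) e)
  (g := fun x => T (YY12 Y e (x ⊗ vac)))) x => [k x y|k x y|a b].
- rewrite /D12 /der scaler_sumr -big_split; apply: eq_bigr => j _.
  by rewrite /= YY12_linearl scalerDr !scalerA mulrC.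
- by rewrite YY12_linearl T_linear.
rewrite D12E YY12_pure; under eq_fun do rewrite YY12_pure.
under [X in _ + Dz X _]eq_fun do rewrite YY12_pure /=.
rewrite /= -/(Dz (Y a (Y b vac e.2)) e.1) -(logva_covariance A).
have -> : Dz (fun x => Y a (Y b vac x) e.1) e.2 = Y a (Dz (Y b vac) e.2) e.1.
  by rewrite /Dz (linD (logva_Y_lin2 _ _)) !(linZ (logva_Y_lin2 _ _)).
by rewrite -(logva_covariance A b) (logva_vacuum_T A) (lin0 (logva_Y_lin2 b _)) subr0 subrK.
Qed.

Lemma iter_op12 k x c : iter k (op12 S) (x ⊗ c) = iter k S x ⊗ c.
Proof.
elim: k => //= k ->; exact: (tmap_pure _ _ (linearP S) (@id_linear _)).
Qed.

Lemma iterS_eq0 x n k : iter n S x = 0 -> (n <= k)%N -> iter k S x = 0.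
Proof.
move=> Sn /subnK <-; rewrite iterD Sn; elim: (k - n)%N => //= m ->.
exact: linear0.
Qed.

Lemma op12_nilpotent x : exists M, forall k, (M <= k)%N -> iter k (op12 S) (x ⊗ vac) = 0.
Proof.
have [M SM] := logva_nilpotence A x; exists M => k Mk.
by rewrite iter_op12 (iterS_eq0 SM Mk) (lin0 (tpure_linl vac)).
Qed.

Section LocalitySeries.
Variables (N : nat) (x : tens V V).

Definition kernel_series : I -> tens (tens V V) V :=
  fscale (fpow (z12 K) N) (fexp_op (theta12 K) (op12 S) (x ⊗ vac)).

Definition locality_series : I -> V := fapp (YY12 Y) kernel_series.

Lemma kernel_supported : exists M, supported (homog N%:Z M) kernel_series.
Proof.
have [M nil] := op12_nilpotent x; exists M.
have := fscale_supported (@fpow_z12_supported K N) (fexp_supported nil).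
by rewrite addr0.
Qed.

Lemma D12_kernel : D12 kernel_series =1 (fun=> 0).
Proof.
have [M nil] := op12_nilpotent x.
apply: D12_fscale (@fpow_z12_supported K N) (fexp_supported nil) _ (D12_fexp nil).
exact: D12_fpow (@z12_supported K) (@D12_z12 K).
Qed.

(** The operator [op12 S] never touches the third factor, so the vacuum lemmas apply to every
    coefficient of the kernel. *)
Lemma kernel_vac e : exists y, kernel_series e = y ⊗ vac.
Proof.
pose Q (v : tens (tens V V) V) := exists y, v = y ⊗ vac.
have Q0 : Q 0 by exists 0; rewrite (lin0 (tpure_linl vac)).
have QD v w : Q v -> Q w -> Q (v + w).
  by move=> [y ->] [z ->]; exists (y + z); rewrite (linD (tpure_linl vac)).
have QZ k v : Q v -> Q (k *: v).
  by move=> [y ->]; exists (k *: y); rewrite (linZ (tpure_linl vac)).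
rewrite /kernel_series /fscale /fapp; apply: (fsum_closed (Q := Q)) => // p _; apply: (QZ).
rewrite /fexp_op; apply: (fsum_closed (Q := Q)) => // k _; apply: QZ.
by rewrite iter_op12; exists (iter k S x).
Qed.

Lemma YY12_kernel_ge0 p q : YY12 Y p (kernel_series q) <> 0 ->
  0 <= p.2.1 /\ p.2.2 = 0%N.
Proof.
have [y ->] := kernel_vac q; move=> ne.
have : ~~ ((p.2.1 < 0) || (0 < p.2.2)%N) by apply/negP => h; apply: ne; exact: YY12_vac0.
by rewrite negb_or -leNgt -leqNgt leqn0 => /andP[h /eqP].
Qed.

Lemma kernel_at0 k :
  kernel_series ((N%:Z, k), 0) = ((k`!%:R)^-1 *: iter k S x) ⊗ vac.
Proof.
have [M nil] := op12_nilpotent x.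
rewrite /kernel_series (fscale_at0 _ _ (@fpow_z12_supported K N) (fexp_supported nil)).
rewrite subr0 big_ord_recr /= big1 => [|l _].
  by rewrite add0r subnn fpow_z12_at0 scale1r (fexp_at0 nil) iter_op12 (linZ (tpure_linl vac)).
(* For [l] < k the factor z12^N would need a positive power of ζ1, and it has none. *)
rewrite (_ : fpow _ _ _ = 0) ?scale0r//; apply: contrapT => /fpow_z12_supported[_ /=].
by have := ltn_ord l; lia.
Qed.

(** Setting z2 = 0 turns the kernel into z1^N e^{ζ1 S} x, so the sum is a coefficient of z1^N Y(z1,
    ζ1) e^{ζ1 S} x. *)
Lemma locality_series_at0 n i : locality_series ((n, i), 0) =
  \sum_(k < i.+1) Yten Y (n - N%:Z, (i - k)%N) ((k`!%:R)^-1 *: iter k S x).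
Proof.
have [M supp] := kernel_supported.
rewrite /locality_series (fapp_at0 YY12_linear _ supp) => [|p q /YY12_kernel_ge0[]//].
by apply: eq_bigr => k _; rewrite kernel_at0 YY12_vac_value.
Qed.

Lemma locality_series_eq0 e : (e.2.1 < 0) || (0 < e.2.2)%N -> locality_series e = 0.
Proof.
move=> he; apply: contrapT => /fapp_neq0[p [q [pq ne]]].
have [p21 p22] := YY12_kernel_ge0 ne.
have [M supp] := kernel_supported; have [q1 q2 q3 _] := supp_arg YY12_linear supp ne.
by move: he; rewrite -pq /=; lia.
Qed.

(** The Leibniz rule leaves only the derivative of the product of fields, since [D12] kills the
    kernel. *)
Lemma D12_locality_series e : D12 locality_series e = T (locality_series e).
Proof.
have [M supp] := kernel_supported.
have fin : summable (YY12 Y) kernel_series.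
  by apply: homog_summable supp; [exact: YY12_linear|move=> p q /YY12_kernel_ge0[]].
rewrite /D12 der_fapp//; [|exact: Dw_add|exact: Ds_inj|exact: Dw_supp|exact: YY12_linear].
rewrite [X in _ + X](_ : _ = 0) ?addr0; last first.
  apply: fsbig1 => -[p q] /= _; have := D12_kernel q; rewrite /D12 => ->.
  exact: lin0 (YY12_linear p).
rewrite /locality_series /fapp (lin_fsum T_linear (fin e))//.
by apply: eq_fsbigr => -[p q] _ /=; have [y ->] := kernel_vac q; exact: D12_YY12_vac.
Qed.
End LocalitySeries.
End LogVA.

(** * Skew-symmetry *)

Section Translation.
Variables (K : numFieldType) (U : lmodType K) (T : {linear U -> U}) (W : nat -> nat -> U).
Hypothesis TW : forall m n,
  T (W m n) = m.+1%:R *: W m.+1 n + n.+1%:R *: W m n.+1.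

(** The coefficient of z1^(k+j) z2^n in z1^k (z2 - z1)^(n+j) / k!, that is, the contribution of T^k
    to e^{z1 T} W(0, z2 - z1). *)
Let c (n k j : nat) : K := (k`!%:R)^-1 * ((-1) ^+ j * 'C(n + j, n)%:R).

Let c_fact n k j : k.+1%:R * c n k.+1 j = c n k j.
Proof.
rewrite /c factS natrM invfM -!mulrA mulVKf// pnatr_eq0//.
Qed.

Let c_bin n k j : j.+1%:R * c n k j.+1 = - (n.+1%:R * c n.+1 k j).
Proof.
have bin : n.+1%:R * 'C(n.+1 + j, n.+1)%:R = j.+1%:R * 'C(n + j.+1, n)%:R :> K.
  by rewrite -!natrM -addSnnS mul_bin_left (_ : (n.+1 + j - n)%N = j.+1); last lia.
rewrite /c exprS; transitivity (- (k`!%:R^-1 * (-1) ^+ j * (j.+1%:R * 'C(n + j.+1, n)%:R)) : K).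
  ring.
by rewrite -bin; ring.
Qed.

(** The hypothesis [TW] gives row [m.+1] from row [m], hence W from its row 0; the closed form is
    e^{z1 T} W(0, z2 - z1). *)
Lemma translation m n : W m n =
  \sum_(k < m.+1) c n k (m - k) *: iter k T (W 0 (n + (m - k))).
Proof.
elim: m n => [|m ih] n.
  by rewrite big_ord1 /c /= !addn0 binn expr0 invr1 !mul1r scale1r.
apply: (@scalerI _ _ m.+1%:R); first by rewrite pnatr_eq0.
have -> : m.+1%:R *: W m.+1 n = T (W m n) - n.+1%:R *: W m n.+1 by rewrite TW addrK.
rewrite scaler_sumr.
(* Splitting m+1 as k + (m+1-k): the first half matches T (W m n) by [c_fact], the second matches
   -(n+1) W m (n+1) by [c_bin]. *)
transitivity (\sum_(k < m.+2) (k%:R * c n k (m.+1 - k)) *: iter k T (W 0 (n + (m.+1 - k)))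
  + \sum_(k < m.+2) ((m.+1 - k)%:R * c n k (m.+1 - k)) *: iter k T (W 0 (n + (m.+1 - k)))).
  congr (_ + _).
    rewrite big_ord_recl mul0r scale0r add0r ih linear_sum.
    by apply: eq_bigr => k _; rewrite linearZ /= /bump add1n c_fact subSS.
  rewrite [RHS]big_ord_recr /= subnn mul0r scale0r addr0 ih scaler_sumr -sumrN.
  apply: eq_bigr => k _; rewrite subSn; last by have := ltn_ord k; lia.
  by rewrite scalerA c_bin addSnnS scaleNr.
rewrite -big_split; apply: eq_bigr => k _ /=.
rewrite -scalerDl -mulrDl -natrD scalerA subnKC//.
by have := ltn_ord k; lia.
Qed.

(** The case z2 = 0, W(z, 0) = e^{zT} W(0, -z), with the sign kept under [iter k T] to match
    [skew_partial]. *)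
Lemma translation0 m : W m 0 =
  \sum_(k < m.+1) (k`!%:R)^-1 *: iter k T ((-1) ^+ (m - k) *: W 0 (m - k)).
Proof.
rewrite translation; apply: eq_bigr => k _.
have -> : iter k T ((-1) ^+ (m - k) *: W 0 (m - k)) = (-1) ^+ (m - k) *: iter k T (W 0 (m - k)).
  by elim: (nat_of_ord k) (m - k)%N => //= k' IH j; rewrite IH linearZ.
by rewrite scalerA /c add0n bin0 mulr1.
Qed.
End Translation.

(** * Identities valid at every large truncation order *)

Section Eventually.
(** The order at which e^{zT} Y(-z) may be truncated depends on the vector; identities stated for
    all large orders can be combined, finitely many at a time, at a common order. *)
Definition eventual (P : nat -> Prop) := exists B0, forall B, (B0 <= B)%N -> P B.

Lemma eventual_impl (P Q : nat -> Prop) :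
  (forall B, P B -> Q B) -> eventual P -> eventual Q.
Proof. by move=> PQ [B0 h]; exists B0 => B /h /PQ. Qed.

Lemma eventual_forall (J : finType) (P : J -> nat -> Prop) :
  (forall j, eventual (P j)) -> eventual (fun B => forall j, P j B).
Proof.
move=> /choice[f fP]; exists (\max_j f j)%N => B fB j; apply: fP.
exact: leq_trans (leq_bigmax j) fB.
Qed.

Lemma eventual_and (P Q : nat -> Prop) :
  eventual P -> eventual Q -> eventual (fun B => P B /\ Q B).
Proof.
move=> [B0 h0] [B1 h1]; exists (maxn B0 B1) => B; rewrite geq_max => /andP[b0 b1].
by split; [exact: h0|exact: h1].
Qed.

Lemma eventual_ex (P : nat -> Prop) : eventual P -> exists B, P B.
Proof. by move=> [B h]; exists B; exact: h. Qed.
End Eventually.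

(** * Koszul signs and the swap *)

Section Koszul.
Variables (K : comNzRingType) (V : superspace K).

Lemma tswap_pure (a b : V) : tswap (a ⊗ b) = koszul (fun a b => b ⊗ a) a b.
Proof.
rewrite /tswap tlift_pure// => {a b} c k x y; rewrite /koszul scaler_sumr -big_split;
  apply: eq_bigr => i _; rewrite scaler_sumr -big_split; apply: eq_bigr => j _ /=.
  by rewrite linearP tpure_linr scalerDr !scalerA mulrC.
by rewrite linearP tpure_linl scalerDr !scalerA mulrC.
Qed.

Lemma tswap_linear : linear (@tswap K V).
Proof.
apply: tlift_linear => c k x y; rewrite /koszul scaler_sumr -big_split;
  apply: eq_bigr => i _; rewrite scaler_sumr -big_split; apply: eq_bigr => j _ /=.
  by rewrite linearP tpure_linr scalerDr !scalerA mulrC.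
by rewrite linearP tpure_linl scalerDr !scalerA mulrC.
Qed.

(** Trading the sign sum for [tswap] makes the commutation of S with the swap applicable. *)
Lemma koszul_lin (U : lmodType K) (f : tens V V -> U) (a b : V) : linear f ->
  koszul (fun a' b' => f (b' ⊗ a')) a b = f (tswap (a ⊗ b)).
Proof.
move=> fl; rewrite tswap_pure /koszul lin_sum//; apply: eq_bigr => i _.
by rewrite lin_sum//; apply: eq_bigr => j _; rewrite linZ.
Qed.

Lemma eq_koszul (U : lmodType K) (F G : V -> V -> U) a b :
  (forall i j, F (sproj i a) (sproj j b) = G (sproj i a) (sproj j b)) ->
  koszul F a b = koszul G a b.
Proof.
by move=> FG; apply: eq_bigr => i _; apply: eq_bigr => j _; rewrite FG.
Qed.

Lemma koszul0 (U : lmodType K) (F : V -> V -> U) a b :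
  (forall a b, F a b = 0) -> koszul F a b = 0.
Proof. by move=> F0; rewrite /koszul big1// => i _; rewrite big1// => j _; rewrite F0 scaler0. Qed.
End Koszul.

(** * From locality to skew-symmetry *)

Section SkewSymmetry.
Local Open Scope classical_set_scope.
Variables (K : numFieldType) (V : superspace K) (A : logVA V).
Local Notation I := (expo * expo)%type.
Local Notation Y := (logva_Y A).
Local Notation S := (logva_S A).
Local Notation T := (logva_T A).
Local Notation vac := (logva_vac A).

Lemma iterS_linear k : linear (iter k S).
Proof. by elim: k => //= k ih c x y; rewrite /= ih linearP. Qed.

Lemma iterT_linear k : linear (iter k T).
Proof. by elim: k => //= k ih c x y; rewrite /= ih linearP. Qed.

Lemma iterS_tswap k x : iter k S (tswap x) = tswap (iter k S x).
Proof. by elim: k => //= k ->; exact: (braiding_swap (logva_braiding A)). Qed.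

(** The right-hand side of locality is the left-hand side with the two variables exchanged; z12^N
    contributes the sign, put on [x] so that [locality_series] serves both sides. *)
Lemma YY21_locality N x e :
  fapp (YY21 Y) (fscale (fpow (z12 K) N) (fexp_op (theta21 K) (op12 S) (x ⊗ vac))) e =
  locality_series A N ((-1) ^+ N *: x) (eswap e).
Proof.
rewrite /locality_series -fapp_eswap /fapp; apply: eq_fsbigr => -[p q] _ /=.
rewrite -[YY21 Y p]/(YY12 Y (eswap p)); congr (YY12 _ _ _).
rewrite /kernel_series -[RHS]/((fscale _ _ \o eswap) q) -fscale_eswap.
have [M nil] := op12_nilpotent A x.
have opl : linear (op12 S) by apply: tmap_linear; [exact: linearP|exact: id_linear].
apply: eq_fsbigr => -[p' q'] _ /=; rewrite fexp_op_eswap fpow_z12_eswap.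
rewrite (linZ (tpure_linl vac)) (fexp_opZ _ _ _ opl nil) scalerA mulrAC -expr2 sqrr_sign.
by rewrite mul1r.
Qed.

Lemma locality_swap a b : exists N, forall e,
  locality_series A N (a ⊗ b) e =
  koszul (fun a' b' => locality_series A N ((-1) ^+ N *: (b' ⊗ a')) (eswap e)) a b.
Proof.
have [N h] := logva_locality A a b; exists N => e.
rewrite /locality_series /kernel_series h; apply: eq_koszul => i j.
exact: YY21_locality.
Qed.

(** By [locality_swap], dependence on ζ1 on one side is dependence on ζ2 on the other, and that
    vanishes. So Y(z, ζ) e^{ζS} x carries no positive power of ζ. *)
Lemma braided_zeta_free n i x : (0 < i)%N ->
  \sum_(k < i.+1) Yten Y (n, (i - k)%N) ((k`!%:R)^-1 *: iter k S x) = 0.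
Proof.
move=> i0; pose f x := \sum_(k < i.+1) Yten Y (n, (i - k)%N) ((k`!%:R)^-1 *: iter k S x).
have fl : linear f.
  move=> c u v; rewrite /f scaler_sumr -big_split; apply: eq_bigr => k _ /=.
  by rewrite iterS_linear scale_linear Yten_linear.
(* The order [N] in locality depends on a and b, whence the reduction to pure tensors. *)
apply: (tens_lin_eq (f := f) (g := fun=> 0)) x => // [c u v|a b].
  by rewrite scaler0 addr0.
have [N h] := locality_swap a b.
have := locality_series_at0 A N (a ⊗ b) (n + N%:Z) i.
rewrite addrK h /f => <-; apply: koszul0 => a' b'; apply: locality_series_eq0.
by rewrite /= i0 orbT.
Qed.

(* The coefficient of e in e^{zT} Y(-z, ζ) x, with e^{zT} truncated at order B;
   the value is stationary in B, and linear in x for fixed B. *)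
Definition skew_partial B (e : expo) (x : tens V V) : V :=
  \sum_(k < B) (k`!%:R)^-1 *:
    iter k T ((-1) ^ (e.1 - k%:Z) *: Yten Y (e.1 - k%:Z, e.2) x).

Lemma skew_partial_linear B e : linear (skew_partial B e).
Proof.
move=> c x y; rewrite /skew_partial scaler_sumr -big_split; apply: eq_bigr => k _ /=.
by rewrite Yten_linear scale_linear iterT_linear scale_linear.
Qed.

(** Here W is an ordinary power series in z1 and z2, so [translation0] compares its two axes,
    computed in [W10] and [W01]. *)
Lemma skew_at_zeta0_pure n a b :
  eventual (fun B => Yten Y (n, 0%N) (a ⊗ b) = skew_partial B (n, 0%N) (tswap (a ⊗ b))).
Proof.
have [N h] := locality_swap a b.
pose W := locality_series A N (a ⊗ b).
have W1 m e : (m < 0) -> W ((m, 0%N), e) = 0.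
  by move=> m0; rewrite /W h; apply: koszul0 => *; apply: locality_series_eq0; rewrite /= m0.
have W1z m e i : W ((m, i.+1), e) = 0.
  by rewrite /W h; apply: koszul0 => *; apply: locality_series_eq0; rewrite /= orbT.
have W2 m e : (m < 0) -> W (e, (m, 0%N)) = 0.
  by move=> m0; apply: locality_series_eq0; rewrite /= m0.
have W2z m e i : W (e, (m, i.+1)) = 0.
  by apply: locality_series_eq0; rewrite /= orbT.
have W10 m : W ((m + N%:Z, 0%N), 0) = Yten Y (m, 0%N) (a ⊗ b).
  by rewrite /W locality_series_at0 big_ord1 addrK /= invr1 scale1r.
have W01 m : W (0, (m + N%:Z, 0%N)) = (-1) ^+ N *: Yten Y (m, 0%N) (tswap (a ⊗ b)).
  rewrite -(koszul_lin (f := fun x => (-1) ^+ N *: Yten Y (m, 0%N) x)); last first.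
    by move=> c x y; rewrite Yten_linear scale_linear.
  rewrite /W h; apply: eq_koszul => i j.
  by rewrite locality_series_at0 big_ord1 addrK /= invr1 scale1r (linZ (Yten_linear A _)).
have TW m n' : T (W ((m%:Z, 0%N), (n'%:Z, 0%N))) =
    m.+1%:R *: W ((m.+1%:Z, 0%N), (n'%:Z, 0%N)) + n'.+1%:R *: W ((m%:Z, 0%N), (n'.+1%:Z, 0%N)).
  rewrite -[T _]D12_locality_series -/W D12E /Dz /= W1z W2z !scaler0 !addr0.
  by rewrite -[m%:Z + 1]/(m%:Z + 1%:Z) -[n'%:Z + 1]/(n'%:Z + 1%:Z) -!PoszD !addn1.
(* W has no negative power of z2, so [W01] bounds by [N] the pole of Y(z) at ζ = 0 on the swapped
   vector. *)
have Ytop k : n + N%:Z < k -> Yten Y (n - k, 0%N) (tswap (a ⊗ b)) = 0.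
  move=> nk; have := W01 (n - k); rewrite W2; last by lia.
  by move=> /esym/eqP; rewrite scaler_eq0 signr_eq0 => /eqP.
(* All terms with k > n + N vanish by [Ytop], which dictates the truncation order. *)
exists (absz (n + N%:Z)).+1 => B hB; rewrite -W10 /skew_partial.
have [neg|] := ltP (n + N%:Z) 0.
  rewrite W1// big1// => k _; rewrite Ytop /=; last by lia.
  by rewrite scaler0 (lin0 (iterT_linear k)) scaler0.
move=> /ZnatP/= [m hm]; move: hB; rewrite hm absz_nat => mB.
rewrite (translation0 (W := fun m n => W ((m%:Z, 0%N), (n%:Z, 0%N))) TW).
rewrite (big_ord_widen _ (fun k => k`!%:R^-1 *: iter k T ((-1) ^+ (m - k) *:
   W ((0, 0%N), ((m - k)%N%:Z, 0%N)))) mB) big_mkcond /=.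
apply: eq_bigr => k _; case: ltnP => km; last first.
  rewrite Ytop ?scaler0 ?(lin0 (iterT_linear k)) ?scaler0//; lia.
congr (_ *: iter _ _ _).
have -> : ((m - k)%N%:Z) = (n - k%:Z) + N%:Z by lia.
rewrite W01 scalerA; congr (_ *: _).
(* The signs (-1)^(m-k) and (-1)^N combine into (-1)^(n-k), since m = n + N and (-1)^-N = (-1)^N. *)
have -> : n - k%:Z = (m - k)%N%:Z - N%:Z by lia.
rewrite expfzDr ?oppr_eq0 ?oner_eq0// -exprnP -invr_expz -exprnP.
by congr (_ * _); rewrite -exprVn invrN1.
Qed.

Lemma skew_at_zeta0 n x :
  eventual (fun B => Yten Y (n, 0%N) x = skew_partial B (n, 0%N) (tswap x)).
Proof.
rewrite (tens_decomp x); elim: (tens_repr x) => [|[a b] s ih].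
  exists 0%N => B _; rewrite big_nil (lin0 (Yten_linear _ _)) (lin0 (@tswap_linear _ _)).
  by rewrite (lin0 (skew_partial_linear _ _)).
apply: eventual_impl (eventual_and (skew_at_zeta0_pure n a b) ih) => B [h1 h2].
rewrite big_cons (linD (Yten_linear _ _)) h1 h2 (linD (@tswap_linear _ _)).
by rewrite (linD (skew_partial_linear _ _)).
Qed.

(** Induction on the power of ζ: [braided_zeta_free] writes the coefficient of ζ^(i+1) through lower
    ones at S^k x / k!, and [iterS_tswap] carries the swap across S. *)
Lemma skew_eventual i n x :
  eventual (fun B => Yten Y (n, i) x = skew_partial B (n, i) (tswap x)).
Proof.
elim/ltn_ind: i n x => -[|i] ih n x; first exact: skew_at_zeta0.
pose z k y : tens V V := (k`!%:R)^-1 *: iter k S y.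
have ev : eventual (fun B => forall k : 'I_i.+1, Yten Y (n, (i - k)%N) (z k.+1 x) =
    skew_partial B (n, (i - k)%N) (tswap (z k.+1 x))).
  by apply: eventual_forall => k; apply: ih; lia.
apply: eventual_impl ev => B hB.
have rec y : Yten Y (n, i.+1) y = - \sum_(k < i.+1) Yten Y (n, (i - k)%N) (z k.+1 y).
  have := braided_zeta_free n y (ltn0Sn i); rewrite big_ord_recl /= invr1 scale1r subn0.
  by move/eqP; rewrite addr_eq0 => /eqP ->.
(* The truncated right-hand side obeys the same recursion, order by order in T, with [n - l] in
   place of [n]. *)
have rec' y : skew_partial B (n, i.+1) y =
    - \sum_(k < i.+1) skew_partial B (n, (i - k)%N) (z k.+1 y).
  apply/eqP; rewrite -addr_eq0 -exchange_big -big_split /=; apply/eqP.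
  apply: big1 => l _.
  rewrite -scaler_sumr -(lin_sum (iterT_linear l)) -scaler_sumr -scalerDr.
  rewrite -(linD (iterT_linear l)) -scalerDr.
  have := braided_zeta_free (n - l%:Z) y (ltn0Sn i).
  rewrite big_ord_recl /= invr1 scale1r subn0 => ->.
  by rewrite scaler0 (lin0 (iterT_linear l)) scaler0.
rewrite rec rec'; congr (- _); apply: eq_bigr => k _; rewrite hB.
by rewrite /z (linZ (@tswap_linear _ _)) iterS_tswap.
Qed.

Lemma exp_zT_partial a b e : eventual (fun B =>
  fapp (exp_zT T) (subst_negz (Y b a)) e = skew_partial B e (b ⊗ a)).
Proof.
case: e => n i; have [_ /(_ i)[L YL]] := logva_Y_field A b a.
(* From this order on n - k < L, so the lower bound [L] on the powers of z in Y(b, z) a at ζ^i kills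
   the term. *)
exists (absz (n - L)).+1 => B hB.
pose h (k : nat) : expo * expo := ((k%:Z, 0%N), (n - k%:Z, i)).
pose F (p : expo * expo) := exp_zT T p.1 (subst_negz (Y b a) p.2).
have -> : skew_partial B (n, i) (b ⊗ a) = \sum_(p <- map h (iota 0 B)) F p.
  rewrite big_map -{2}(subn0 B) -/(index_iota 0 B) big_mkord.
  by apply: eq_bigr => k _; rewrite /F /= Yten_pure.
have hE k : (h k).1 + (h k).2 = (n, i) by rewrite /h; congr (_, _) => /=; lia.
rewrite /fapp (fsbigE (map h (iota 0 B))) ?map_inj_uniq ?iota_uniq//; last 3 first.
- by move=> k l [].
- by move=> _ /= /seq.mapP[k _ ->]; exact: hE.
- move=> [[p1 p2] [q1 q2]] /= [pq1 pq2] /negP notin; apply: contrapT => ne; apply: notin.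
  case: p1 p2 pq1 pq2 ne => k [|//]; rewrite ?scaler0// => pq1 pq2 ne.
  have kq : ((k%:Z, 0%N), (q1, q2)) = h k by rewrite /h -pq1 -pq2; congr (_, (_, _)); lia.
  rewrite kq map_f// mem_iota /= add0n.
  rewrite ltnNge; apply/negP => Bk; apply: ne.
  rewrite /subst_negz /= -[q2]/((q1, q2).2) (_ : Y b a _ = 0).
    by rewrite scaler0 (lin0 (iterT_linear k)) scaler0.
  have -> : (q1, (q1, q2).2) = (q1, i) by congr (_, _); move: pq2 => /=; lia.
  apply: YL; lia.
rewrite big_seq_cond [RHS]big_seq; apply: eq_bigl => p.
by apply: andb_idr => /seq.mapP[k _ ->]; apply/mem_set/hE.
Qed.

Lemma skew_symmetry a b e : Y a b e =
  koszul (fun a' b' => fapp (exp_zT T) (subst_negz (Y b' a')) e) a b.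
Proof.
(* One truncation order serves the four pairs of homogeneous components. *)
have ev : eventual (fun B => forall ij : bool * bool,
    fapp (exp_zT T) (subst_negz (Y (sproj ij.2 b) (sproj ij.1 a))) e =
    skew_partial B e (sproj ij.2 b ⊗ sproj ij.1 a)).
  by apply: eventual_forall => ij; exact: exp_zT_partial.
case: e ev => n i ev.
have [B [hB skew]] := eventual_ex (eventual_and ev (skew_eventual i n (a ⊗ b))).
rewrite -(Yten_pure A) skew -(koszul_lin _ _ (skew_partial_linear B (n, i))).
by apply: eq_koszul => k l; rewrite (hB (k, l)).
Qed.

Lemma skew_symmetry_zeta0 a b e : logva_X A a b e =
  koszul (fun a' b' => fapp (exp_zT T) (subst_negz (logva_X A b' a')) e) a b.
Proof.
case: e => n i; rewrite /logva_X {1}/subst_zeta0 /=; case: eqP => [->|/eqP i0].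
  (* Exponents of ζ are natural numbers, so pairs adding up to ζ^0 have ζ-exponent 0 in both
     factors, where [subst_zeta0] changes nothing. *)
  rewrite skew_symmetry; apply: eq_koszul => k l; apply: eq_fsbigr => -[p q] /set_mem /= [_ pq].
  congr (exp_zT _ _ _); rewrite /subst_negz /subst_zeta0 ifT//.
  by apply/eqP; move: pq; lia.
(* For i > 0 both sides vanish: e^{zT} has no ζ, so ζ^i would have to come from a series in which ζ
   is set to 0. *)
apply/esym/koszul0 => a' b'; apply: fsbig1 => -[[[p1|p1] [|p2]] [q1 q2]] //= [_ pq].
rewrite /subst_negz /subst_zeta0 /= ifF ?scaler0 ?(lin0 (iterT_linear _)) ?scaler0//.
by apply/negP => /eqP q20; move: i0 pq; lia.
Qed.

End SkewSymmetry.

Theorem proposition3p22 (R : realType) (V : superspace R[i]) (A : logVA V)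
    (a b : V) :
  (forall e : expo,
     logva_Y A a b e =
     koszul (fun a' b' =>
       fapp (exp_zT (logva_T A)) (subst_negz (logva_Y A b' a')) e) a b) /\
  (forall e : expo,
     logva_X A a b e =
     koszul (fun a' b' =>
       fapp (exp_zT (logva_T A)) (subst_negz (logva_X A b' a')) e) a b).
Proof. by split=> e; [exact: skew_symmetry|exact: skew_symmetry_zeta0]. Qed.
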